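(* The gauged Laplacian $L_\chi:\Gamma\to\Gamma$ is the unique gauge invariant transformation that (1) is locally Laplacian and satisfies the integrability condition; (2) satisfies the tree blow-up lifting property. The gauged heat kernel $K_\chi$ is distinguished by the fact that its generator is the unique operator which has these properties.
   Context: **Graph and data.** $\eta$ is a finite, connected, simple, directed graph with vertex set $\nu=\{1,\dots,N\}$, directed edge relation $<$ (so $i<j$ means that there is a directed edge from $i$ to $j$; $j>i$ means the same) and edge set $\varepsilon$. $i\sim j$ means $i<j$ or $j<i$. $\kappa:\nu\times\nu\to\mathbb{R}_{\ge0}$ is a symmetric weight function, positive on edges, with $\kappa_{ij}=0$ if $i\not\sim j$; $Z_i=\sum_{j\in\nu}\kappa_{ij}$. Fix a dimension $d>0$; $X=\mathbb{R}^{N\times d}=(\mathbb{R}^d)^N$. The group $\Xi=\mathrm{SO}(d)^N$ (elements are called gauges) acts on $X$ by $(\xi x)_i=\xi_i x_i$. **Sections.** $\Gamma=(\Xi\times X)/\Xi$ is the set of classes $[\xi,x]$ of pairs $(\xi,x)\in\Xi\times X$ under the identifications $[\xi\tau,x]=[\xi,\tau x]$, $\tau\in\Xi$. It is a vector space via $[\xi,x]+[\xi,x']=[\xi,x+x']$, $r[\xi,x]=[\xi,rx]$. With $Y=(\mathrm{SO}(d)\times\mathbb{R}^d)/\mathrm{SO}(d)$ (the same construction for one node) one has $\Gamma=Y^N$, $[\xi,x]_i=[\xi_i,x_i]$. **Gauge invariant transformations.** These are the maps $\mathcal{F}:\Gamma\to\Gamma$. To $\mathcal{F}$ corresponds the function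 $F:\Xi\times X\to X$ with $\mathcal{F}([\xi,x])=[\xi,F(\xi,x)]$; it satisfies $F(\xi h^{-1},hx)=hF(\xi,x)$ for all $h\in\Xi$. **Voltages.** $\mathcal{A}$ is the set of $\mathrm{SO}(d)$ graph voltages: functions $\alpha:\nu\times\nu\to\mathrm{SO}(d)$ with $\alpha_{ij}=\mathbf{I}$ (the identity matrix) if $i\not\sim j$ and $\alpha_{ij}=\alpha_{ji}^{-1}$ otherwise. $\Xi$ acts on $\mathcal{A}$ by $(\xi\alpha)_{ij}=\xi_i\alpha_{ij}\xi_j^{-1}$. $\Omega=(\Xi\times\mathcal{A})/\Xi$ is the set of classes $[\xi,\alpha]$ with $[\xi\tau,\alpha]=[\xi,\tau\alpha]$; its elements are gauge invariant voltages. A gauge invariant voltage graph is a triple $\chi=(\eta,\kappa,\omega)$ with $\omega\in\Omega$. **Gauged Laplacian and heat kernel.** For a gauge invariant voltage graph $\chi=(\eta,\kappa,\omega)$, $\omega=[\xi,\alpha]$, the gauged Laplacian $L_\chi:\Gamma\to\Gamma$ is the linear operator $L_\chi([\xi,x])=[\xi,\Delta_{\eta,\kappa,\alpha}x]$ with $(\Delta_{\eta,\kappa,\alpha}x)_i=-\sum_{j\in\nu}\frac{\kappa_{ij}}{Z_i}(\alpha_{ij}x_j-x_i)$, where section and voltage are represented with the same gauge $\xi$ (this is well defined). The gauged heat kernel is $K_\chi^t=e^{-tL_\chi}$, and $L_\chi$ is called its generator. **Property (1).** $\mathcal{F}$ is locally Laplacian if for every $i\in\nu$ there is a gauge $\xi^i\in\Xi$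 such that for every $\phi=[\xi^i,x]\in\Gamma$ one has $\mathcal{F}([\xi^i,x])=[\xi^i,y^i(x)]$, $y^i(x)=F(\xi^i,x)$, with $y^i(x)_i=-\sum_{j\in\nu}\frac{\kappa_{ij}}{Z_i}(x_j-x_i)$. The associated gauges are $\xi^{ij}=(\xi^i)^{-1}\xi^j\in\Xi$ for $i,j\in\nu$. The integrability condition is that the associated gauges satisfy $\xi^{ij}_i=\xi^{ij}_j$ for all $i,j\in\nu$ (subscripts denote components in $\mathrm{SO}(d)$). **Tree blow-up.** Start with a spanning tree $\tilde\eta\subset\eta$, writing $\tilde i$ for the vertex corresponding to $i\in\nu$, oriented by $\tilde i>\tilde j$ iff $i>j$. For every edge $i>j$ of $\eta$ not in the spanning tree, add a new vertex $I$ and a new edge between $\tilde j$ and $I$ with orientation $I>\tilde j$. The resulting graph $\tilde\eta$, with vertex set $\tilde\nu$, $\tilde N=|\tilde\nu|$, is a tree, called a tree blow-up of $\eta$; its edges correspond bijectively to those of $\eta$. The surjection $\pi:\tilde\nu\to\nu$ is given by $\pi(\tilde i)=i$ and $\pi(I)=i$ for the new vertex $I$ added for the edge $i>j$. $\tilde\eta$ inherits the symmetric edge weight function $\tilde\kappa_{IJ}=\kappa_{\pi(I)\pi(J)}$, which as a weight function on $\tilde\eta$ is supported on adjacent pairs ($\tilde\kappa_{IJ}=0$ if $I,J$ are not adjacent in $\tilde\eta$). Put $\tilde X=\mathbb{R}^{\tilde N\times d}$, $\tilde\Xi=\mathrm{SO}(d)^{\tilde N}$ (acting on $\tilde X$ by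 $(\tilde\xi\tilde x)_I=\tilde\xi_I\tilde x_I$), $\tilde\Gamma=(\tilde\Xi\times\tilde X)/\tilde\Xi=Y^{\tilde N}$. For $\tilde\xi\in\tilde\Xi$, $\Sigma_{\tilde\xi}:\tilde\Gamma\to\tilde X$ is the isomorphism $[\tilde h,\tilde x]\mapsto\tilde\xi^{-1}\tilde h\tilde x$. The maps $\sigma_1:\Gamma\to\tilde\Gamma$ and $\sigma_2:\tilde\Gamma\to\Gamma$ are $\sigma_1(\phi)_I=\phi_{\pi(I)}$ and $\sigma_2(\tilde\phi)_i=\sum_{I\in\pi^{-1}(i)}\tilde\phi_I$. The operator $\tilde\Delta_{\tilde\eta,\tilde\kappa}:\tilde X\to\tilde X$ is $(\tilde\Delta_{\tilde\eta,\tilde\kappa}\tilde x)_I=-\sum_{J\in\tilde\nu}\frac{\tilde\kappa_{IJ}}{Z_{\pi(I)}}(\tilde x_J-\tilde x_I)$. **Property (2).** Given a tree blow-up $\tilde\eta$ of $\eta$, $\mathcal{F}$ satisfies the tree blow-up lifting property if there is a gauge $\tilde\xi\in\tilde\Xi$ with $\mathcal{F}=\sigma_2\circ\Sigma_{\tilde\xi}^{-1}\circ\tilde\Delta_{\tilde\eta,\tilde\kappa}\circ\Sigma_{\tilde\xi}\circ\sigma_1$.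
   Formalization: The gauge action on voltages is applied on adjacent pairs only (as written it breaks α_ij = I off edges, so Ω is undefined), and uniqueness means: each transformation with (1), or with (2), is L_χ for exactly one ω in Ω. *)

(* Defs.v *)
From HB Require Import structures.
From mathcomp Require Import all_boot all_order all_algebra.
From mathcomp Require Import all_classical all_reals all_analysis.

Set Implicit Arguments.
Unset Strict Implicit.
Unset Printing Implicit Defensive.

Import GRing.Theory Num.Theory.
Import numFieldNormedType.Exports.

Local Open Scope ring_scope.
Local Open Scope quotient_scope.
Local Open Scope classical_set_scope.

(** * Associated bundles (G x V) / G *)

Record action (G : groupType) (V : Type) := Action {
  act_fun :> G -> V -> V;
  act1 : forall v, act_fun 1%g v = v;
  actM : forall g h v, act_fun (g * h)%g v = act_fun g (act_fun h v) }.

Record lin_action (R : comNzRingType) (G : groupType) (V : lmodType R) :=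
  LinAction {
    lin_act :> action G V;
    lin_actP : forall g, linear (lin_act g) }.

Section Associated.
Variables (G : groupType) (V : choiceType) (a : action G V).

Definition assoc_rel : rel (G * V) := fun p q =>
  `[< exists tau : G, p.1 = (q.1 * tau)%g /\ q.2 = a tau p.2 >].

Lemma assoc_relE p q : assoc_rel p q = (q.2 == a (q.1^-1 * p.1)%g p.2).
Proof.
apply/asboolP/eqP => [[tau [-> ->]]|->]; first by rewrite mulKg.
by exists (q.1^-1 * p.1)%g; rewrite mulVKg.
Qed.

Lemma assoc_rel_equiv : equiv_class_of assoc_rel.
Proof.
have sym : symmetric assoc_rel.
  suff H p q : assoc_rel p q -> assoc_rel q p by move=> p q; apply/idP/idP; exact: H.
  rewrite !assoc_relE => /eqP ->.
  by rewrite -actM -mulgA mulVKg mulVg act1.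
split=> // [p|q p r]; first by rewrite assoc_relE mulVg act1.
rewrite !assoc_relE => /eqP Hq /eqP ->.
by rewrite Hq -actM -mulgA mulVKg.
Qed.

Canonical assoc_equiv := EquivRelPack assoc_rel_equiv.

Definition assoc : Type := {eq_quot assoc_equiv}.
HB.instance Definition _ := Choice.on assoc.
HB.instance Definition _ := Quotient.on assoc.

Definition cls (g : G) (v : V) : assoc := \pi_assoc (g, v).

(* the value in the gauge g: [h, v] |-> g^-1 h v, inverse to [cls g] *)
Definition frame (g : G) (p : assoc) : V :=
  a (g^-1 * (repr p).1)%g (repr p).2.

Lemma cls_act g tau v : cls (g * tau)%g v = cls g (a tau v).
Proof. by apply/eqmodP/asboolP; exists tau. Qed.

Lemma frame_cls g h v : frame g (cls h v) = a (g^-1 * h)%g v.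
Proof.
have : \pi_({eq_quot assoc_equiv}) (repr (cls h v))
    = \pi_({eq_quot assoc_equiv}) (h, v) by exact: reprK.
move/eqmodP => /=; rewrite assoc_relE /= /frame => /eqP E.
by rewrite [in RHS]E -actM -mulgA mulVKg.
Qed.

Lemma clsK g : cancel (cls g) (frame g).
Proof. by move=> v; rewrite frame_cls mulVg act1. Qed.

Lemma frameK g : cancel (frame g) (cls g).
Proof.
move=> p; rewrite /frame -cls_act mulVKg /cls.
by rewrite -surjective_pairing reprK.
Qed.

End Associated.

Section LinAssociated.
Variables (R : comNzRingType) (G : groupType) (V : lmodType R).
Variable a : lin_action G V.

Definition lassoc : Type := assoc a.
HB.instance Definition _ := Choice.on lassoc.

Implicit Types p q : lassoc.

Definition lassoc_zero : lassoc := cls a 1%g 0.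
Definition lassoc_add p q : lassoc :=
  cls a (repr p).1 ((repr p).2 + frame (repr p).1 q).
Definition lassoc_opp p : lassoc := cls a (repr p).1 (- (repr p).2).
Definition lassoc_scale (r : R) p : lassoc :=
  cls a (repr p).1 (r *: (repr p).2).

Lemma lactD g : {morph a g : u v / u + v}.
Proof. by move=> u v; have := lin_actP a g 1 u v; rewrite !scale1r. Qed.
Lemma lact0 g : a g 0 = 0.
Proof. by apply: (addrI (a g 0)); rewrite -lactD !addr0. Qed.
Lemma lactZ g r : {morph a g : u / r *: u}.
Proof. by move=> u; have := lin_actP a g r u 0; rewrite lact0 !addr0. Qed.
Lemma lactN g : {morph a g : u / - u}.
Proof. by move=> u; rewrite -!scaleN1r lactZ. Qed.

Lemma frame_repr (g : G) p : a (g^-1 * (repr p).1)%g (repr p).2 = frame g p.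
Proof. by []. Qed.

Lemma frameD g p q : frame g (lassoc_add p q) = frame g p + frame g q.
Proof.
rewrite frame_cls lactD frame_repr; congr (_ + _).
by rewrite -{2}(frameK (repr p).1 q) frame_cls.
Qed.
Lemma frame0 g : frame g lassoc_zero = 0.
Proof. by rewrite frame_cls lact0. Qed.
Lemma frameN g p : frame g (lassoc_opp p) = - frame g p.
Proof. by rewrite frame_cls lactN. Qed.
Lemma frameZ g r p : frame g (lassoc_scale r p) = r *: frame g p.
Proof. by rewrite frame_cls lactZ. Qed.

Let frameI : injective (@frame G V a 1%g) := can_inj (frameK (a := a) 1%g).

Fact lassoc_addA : associative lassoc_add.
Proof. by move=> p q r; apply: frameI; rewrite !frameD addrA. Qed.
Fact lassoc_addC : commutative lassoc_add.
Proof. by move=> p q; apply: frameI; rewrite !frameD addrC. Qed.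
Fact lassoc_add0 : left_id lassoc_zero lassoc_add.
Proof. by move=> p; apply: frameI; rewrite frameD frame0 add0r. Qed.
Fact lassoc_addN : left_inverse lassoc_zero lassoc_opp lassoc_add.
Proof. by move=> p; apply: frameI; rewrite frameD frameN frame0 addNr. Qed.

HB.instance Definition _ :=
  GRing.isZmodule.Build lassoc lassoc_addA lassoc_addC lassoc_add0 lassoc_addN.

Fact lassoc_scaleA r s p :
  lassoc_scale r (lassoc_scale s p) = lassoc_scale (r * s) p.
Proof. by apply: frameI; rewrite !frameZ scalerA. Qed.
Fact lassoc_scale1 : left_id 1 lassoc_scale.
Proof. by move=> p; apply: frameI; rewrite frameZ scale1r. Qed.
Fact lassoc_scaleDr : right_distributive lassoc_scale +%R.
Proof.
by move=> r p q; apply: frameI; rewrite !(frameD, frameZ) scalerDr.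
Qed.
Fact lassoc_scaleDl p : {morph lassoc_scale^~ p : r s / r + s}.
Proof. by move=> r s; apply: frameI; rewrite !(frameD, frameZ) scalerDl. Qed.

HB.instance Definition _ := GRing.Zmodule_isLmodule.Build R lassoc
  lassoc_scaleA lassoc_scale1 lassoc_scaleDr lassoc_scaleDl.

Lemma cls_linear g : linear (cls a g : V -> lassoc).
Proof.
move=> r u v; apply: (can_inj (frameK (a := a) g)).
by rewrite (frameD g (r *: _)) (frameZ g r) !clsK.
Qed.

Lemma frame_linear g : linear (frame g : lassoc -> V).
Proof. by move=> r p q; rewrite frameD frameZ. Qed.

End LinAssociated.

Section VectAssociated.
Import VectorInternalTheory.
Variables (R : comNzRingType) (G : groupType) (V : vectType R).
Variable a : lin_action G V.

Fact lassoc_vect_iso : Vector.axiom (dim V) (lassoc a).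
Proof.
exists (v2r \o frame (a := a) 1%g); first by move=> r p q /=; rewrite frame_linear linearP.
exists (cls a 1%g \o @r2v R V); first by move=> p /=; rewrite v2rK frameK.
by move=> p /=; rewrite clsK r2vK.
Qed.

HB.instance Definition _ :=
  Lmodule_hasFinDim.Build R (lassoc a) lassoc_vect_iso.

End VectAssociated.

(** * The exponential of an operator on a finite dimensional vector space *)

(* The series sum_k A^k v / k! is summed in the coordinates of a basis: the
   space being finite dimensional, the sum does not depend on the basis. *)
Definition op_exp (R : realType) (V : vectType R) (A : V -> V) (v : V) : V :=
  \sum_(i < \dim {:V})
    limn (series (fun k : nat => coord (vbasis {:V}) i (iter k A v) / k`!%:R))
    *: (vbasis {:V})`_i.

Definition is_generator (R : realType) (V : vectType R)
    (K : R -> V -> V) (A : V -> V) : Prop :=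
  linear A /\ forall t : R, 0 <= t -> K t =1 op_exp (fun v => (- t) *: A v).

(** * The group SO(d) *)

Section SO.
Variables (R : realType) (d : nat).

Record SO := MkSO {
  so_mx :> 'M[R]_d;
  so_mxP : (so_mx *m so_mx^T == 1%:M) && (\det so_mx == 1) }.

HB.instance Definition _ := [isSub for so_mx].
HB.instance Definition _ := [Choice of SO by <:].

Fact so1_proof : (1%:M *m (1%:M : 'M[R]_d)^T == 1%:M)
  && (\det (1%:M : 'M[R]_d) == 1).
Proof. by rewrite trmx1 mulmx1 det1 !eqxx. Qed.

Fact soM_proof (g h : SO) :
  (g *m h *m (g *m h)^T == 1%:M) && (\det (g *m h) == 1).
Proof.
case/andP: (so_mxP g) => /eqP gT /eqP dg; case/andP: (so_mxP h) => /eqP hT /eqP dh.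
by rewrite trmx_mul mulmxA -(mulmxA (so_mx g)) hT mulmx1 gT det_mulmx dg dh mulr1 !eqxx.
Qed.

Fact soV_proof (g : SO) : (g^T *m g^T^T == 1%:M) && (\det g^T == 1).
Proof.
case/andP: (so_mxP g) => /eqP gT /eqP dg.
by rewrite trmxK (mulmx1C gT) det_tr dg !eqxx.
Qed.

Definition so1 : SO := MkSO so1_proof.
Definition soM g h : SO := MkSO (soM_proof g h).
Definition soV g : SO := MkSO (soV_proof g).

Fact soA : associative soM.
Proof. by move=> f g h; apply/val_inj; rewrite /= mulmxA. Qed.
Fact so1g : left_id so1 soM.
Proof. by move=> g; apply/val_inj; rewrite /= mul1mx. Qed.
Fact sog1 : right_id so1 soM.
Proof. by move=> g; apply/val_inj; rewrite /= mulmx1. Qed.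
Fact soVg : left_inverse so1 soV soM.
Proof.
move=> g; apply/val_inj => /=.
by case/andP: (so_mxP g) => /eqP /mulmx1C.
Qed.
Fact sogV : right_inverse so1 soV soM.
Proof. by move=> g; apply/val_inj => /=; case/andP: (so_mxP g) => /eqP. Qed.

HB.instance Definition _ := isGroup.Build SO soA so1g sog1 soVg sogV.

End SO.

(** * Sections over a finite set of nodes *)

Section Sections.
Variables (R : realType) (d : nat).

Definition so_act (g : SO R d) (v : 'cV[R]_d) : 'cV[R]_d := g *m v.
Fact so_act1 v : so_act 1%g v = v. Proof. exact: mul1mx. Qed.
Fact so_actM g h v : so_act (g * h)%g v = so_act g (so_act h v).
Proof. by rewrite /so_act -mulmxA. Qed.
Definition so_action := Action so_act1 so_actM.
Fact so_actP g : linear (so_action g).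
Proof. by move=> r u v; rewrite /= /so_act linearP. Qed.
Definition so_lin_action : lin_action (SO R d) 'cV[R]_d := LinAction so_actP.

(* the space Y *)
Definition fibre := lassoc so_lin_action.
HB.instance Definition _ := Vector.on fibre.

Variable I : finType.

(* Xi and X *)
Definition gauge := {ffun I -> SO R d}.
HB.instance Definition _ := Group.on gauge.
Definition signal := {ffun I -> 'cV[R]_d}.
HB.instance Definition _ := Vector.on signal.

Definition gauge_act (xi : gauge) (x : signal) : signal := [ffun i => xi i *m x i].
Fact gauge_act1 x : gauge_act 1%g x = x.
Proof. by apply/ffunP => i; rewrite !ffunE mul1mx. Qed.
Fact gauge_actM g h x : gauge_act (g * h)%g x = gauge_act g (gauge_act h x).
Proof. by apply/ffunP => i; rewrite !ffunE /= mulmxA. Qed.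
Definition gauge_action := Action gauge_act1 gauge_actM.
Fact gauge_actP g : linear (gauge_action g).
Proof.
by move=> r u v; apply/ffunP => i; rewrite !ffunE /= linearP.
Qed.
Definition gauge_lin_action : lin_action gauge signal := LinAction gauge_actP.

(* the space Gamma; [sec xi x] is the class [xi, x] and [triv xi] is the
   isomorphism [h, x] |-> xi^-1 h x, with inverse [sec xi] *)
Definition Sec := lassoc gauge_lin_action.
HB.instance Definition _ := Vector.on Sec.

Definition sec (xi : gauge) (x : signal) : Sec := cls gauge_lin_action xi x.
Definition triv (xi : gauge) (phi : Sec) : signal := frame xi phi.

(* the identification of Gamma with the I-indexed families in Y *)
Definition sec_at (phi : Sec) (i : I) : fibre :=
  cls so_lin_action ((repr phi).1 i) ((repr phi).2 i).
Definition sec_of (y : I -> fibre) : Sec :=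
  sec [ffun i => (repr (y i)).1] [ffun i => (repr (y i)).2].

Lemma sec_at_sec xi x i :
  sec_at (sec xi x) i = cls so_lin_action (xi i) (x i).
Proof.
rewrite /sec_at; set p := repr _.
have /(congr1 (frame xi)) : sec p.1 p.2 = sec xi x.
  by rewrite /sec /cls -surjective_pairing reprK.
rewrite clsK frame_cls => /ffunP/(_ i); rewrite !ffunE /= => <-.
rewrite -[_ *m _]/(so_lin_action ((xi i)^-1 * p.1 i)%g (p.2 i)) -cls_act.
by rewrite mulVKg.
Qed.

Lemma sec_atK : cancel sec_at sec_of.
Proof.
move=> phi; apply: (can_inj (frameK (a := gauge_lin_action) 1%g)).
rewrite frame_cls [RHS]/frame; apply/ffunP => i; rewrite !ffunE /=.
have /(congr1 (frame 1%g)) :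
    cls so_lin_action (repr (sec_at phi i)).1 (repr (sec_at phi i)).2
    = sec_at phi i.
  by rewrite /cls -surjective_pairing reprK.
by rewrite !frame_cls; apply.
Qed.

Lemma sec_ofK y : sec_at (sec_of y) =1 y.
Proof.
move=> i; rewrite sec_at_sec !ffunE.
by rewrite /cls -surjective_pairing reprK.
Qed.

(* the function F(xi, x) with F([xi, x]) = [xi, F(xi, x)] *)
Definition in_gauge (F : Sec -> Sec) (xi : gauge) (x : signal) : signal :=
  triv xi (F (sec xi x)).

Lemma in_gaugeE F xi x : F (sec xi x) = sec xi (in_gauge F xi x).
Proof. by rewrite /sec /in_gauge /triv frameK. Qed.

Lemma in_gauge_equivariant F xi h x :
  in_gauge F (xi * h^-1)%g (gauge_action h x)
  = gauge_action h (in_gauge F xi x).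
Proof.
rewrite /in_gauge /triv /sec -(cls_act gauge_lin_action) mulgVK.
rewrite -{1}(frameK xi (F _)) frame_cls; congr (gauge_action _ _).
by rewrite invgM invgK mulgVK.
Qed.

End Sections.

(** * Graphs, weights, voltages *)

(* [e i j] means that there is a directed edge from i to j, i.e. i < j *)
Definition adj (I : finType) (e : rel I) : rel I := fun i j => e i j || e j i.

Definition connected_graph (I : finType) (e : rel I) : Prop :=
  forall i j, connect (adj e) i j.

Definition acyclic (I : finType) (e : rel I) : Prop :=
  forall c : seq I, ucycle (adj e) c -> (size c <= 2)%N.

(* [edge_asym] excludes both loops and pairs of opposite edges *)
Record connected_simple_digraph (N : nat) (e : rel 'I_N) : Prop := {
  edge_asym : forall i j, e i j -> ~~ e j i;
  edge_connected : connected_graph e }.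

Record edge_weight (R : realType) (N : nat) (e : rel 'I_N)
    (kappa : 'I_N -> 'I_N -> R) : Prop := {
  weight_sym : forall i j, kappa i j = kappa j i;
  weight_gt0 : forall i j, adj e i j -> 0 < kappa i j;
  weight_eq0 : forall i j, ~~ adj e i j -> kappa i j = 0 }.

Section GaugedLaplacian.
Variables (R : realType) (N d : nat) (e : rel 'I_N) (kappa : 'I_N -> 'I_N -> R).

Local Notation Xi := (gauge R d 'I_N).
Local Notation X := (signal R d 'I_N).
Local Notation Gamma := (Sec R d 'I_N).

Definition is_voltage (al : {ffun 'I_N -> {ffun 'I_N -> SO R d}}) : bool :=
  [forall i, forall j,
    if adj e i j then al i j == (al j i)^-1%g else al i j == 1%g].

Record voltage := Voltage {
  voltage_fun :> {ffun 'I_N -> {ffun 'I_N -> SO R d}};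
  voltageP : is_voltage voltage_fun }.

HB.instance Definition _ := [isSub for voltage_fun].
HB.instance Definition _ := [Choice of voltage by <:].

(* The formula xi_i al_ij xi_j^-1 is used on adjacent pairs only: off the edges
   it would break the normalisation al_ij = 1. *)
Definition voltage_act_fun (xi : Xi) (al : voltage) :=
  [ffun i => [ffun j =>
    if adj e i j then (xi i * al i j * (xi j)^-1)%g else 1%g]].

Lemma adjC i j : adj e i j = adj e j i. Proof. exact: orbC. Qed.

Lemma voltage_adj (al : voltage) i j : adj e i j -> al i j = (al j i)^-1%g.
Proof.
by move=> ij; have /forallP/(_ i)/forallP/(_ j) := voltageP al; rewrite ij => /eqP.
Qed.

Lemma voltage_nadj (al : voltage) i j : ~~ adj e i j -> al i j = 1%g.
Proof.
move=> /negbTE ij.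
by have /forallP/(_ i)/forallP/(_ j) := voltageP al; rewrite ij => /eqP.
Qed.

Fact voltage_act_proof xi al : is_voltage (voltage_act_fun xi al).
Proof.
apply/forallP => i; apply/forallP => j; rewrite !ffunE -(adjC i j).
case: ifP => ij; rewrite ?ij ?eqxx //.
by rewrite (voltage_adj al ij) !invgM invgK mulgA.
Qed.

Definition voltage_act xi al : voltage := Voltage (voltage_act_proof xi al).
Fact voltage_act1 al : voltage_act 1%g al = al.
Proof.
apply/val_inj/ffunP => i; apply/ffunP => j; rewrite /= !ffunE.
by case: ifPn => [_|/voltage_nadj //]; rewrite mul1g invg1 mulg1.
Qed.
Fact voltage_actM g h al :
  voltage_act (g * h)%g al = voltage_act g (voltage_act h al).
Proof.
apply/val_inj/ffunP => i; apply/ffunP => j; rewrite /= !ffunE.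
by case: ifP => ij //; rewrite invgM !mulgA.
Qed.
Definition voltage_action := Action voltage_act1 voltage_actM.

(* the space Omega and the class [xi, al] *)
Definition gvoltage := assoc voltage_action.
Definition gvolt (xi : Xi) (al : voltage) : gvoltage := cls voltage_action xi al.

Definition degree (i : 'I_N) : R := \sum_j kappa i j.

Definition laplacian (al : voltage) (x : X) : X :=
  [ffun i => - \sum_j (kappa i j / degree i) *: (al i j *m x j - x i)].

Definition gauged_laplacian (om : gvoltage) (phi : Gamma) : Gamma :=
  sec (repr om).1 (laplacian (repr om).2 (triv (repr om).1 phi)).

Definition heat_kernel (om : gvoltage) (t : R) : Gamma -> Gamma :=
  op_exp (fun phi => (- t) *: gauged_laplacian om phi).

Section WellDefined.
Hypothesis kappaP : edge_weight e kappa.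

Lemma laplacian_act xi al x :
  laplacian (voltage_action xi al) (gauge_action R d 'I_N xi x)
  = gauge_action R d 'I_N xi (laplacian al x).
Proof.
apply/ffunP => i; rewrite !ffunE /= mulmxN mulmx_sumr; congr (- _).
apply: eq_bigr => j _; rewrite -scalemxAr.
have [ij|ij] := boolP (adj e i j); last first.
  by rewrite (weight_eq0 kappaP ij) mul0r !scale0r.
rewrite /= !ffunE ij mulmxBr; congr (_ *: (_ - _)).
rewrite /= -!mulmxA; congr (_ *m (_ *m _)).
by rewrite -[LHS]/(so_act (xi j)^-1%g (so_act (xi j) (x j))) -so_actM mulVg
  so_act1.
Qed.

Lemma gauged_laplacianE xi al x :
  gauged_laplacian (gvolt xi al) (sec xi x) = sec xi (laplacian al x).
Proof.
rewrite /gauged_laplacian; set p := repr _.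
have Hp : gvolt p.1 p.2 = gvolt xi al.
  by rewrite /gvolt /cls -surjective_pairing reprK.
have -> : p.2 = voltage_action (p.1^-1 * xi)%g al.
  by rewrite -(frame_cls voltage_action) -[cls _ _ _]/(gvolt xi al) -Hp clsK.
rewrite /triv /sec frame_cls laplacian_act.
by rewrite -(cls_act (gauge_lin_action R d 'I_N)) mulVKg.
Qed.

End WellDefined.

(** * Locally Laplacian transformations *)

(* [xi i] is the gauge xi^i at the node i *)
Definition locally_laplacian_in (F : Gamma -> Gamma) (xi : 'I_N -> Xi) : Prop :=
  forall i x, in_gauge F (xi i) x i
    = - \sum_j (kappa i j / degree i) *: (x j - x i).

Definition associated_gauge (xi : 'I_N -> Xi) (i j : 'I_N) : Xi :=
  ((xi i)^-1 * xi j)%g.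

Definition integrable_gauges (xi : 'I_N -> Xi) : Prop :=
  forall i j, associated_gauge xi i j i = associated_gauge xi i j j.

Definition locally_laplacian_integrable (F : Gamma -> Gamma) : Prop :=
  exists2 xi : 'I_N -> Xi, locally_laplacian_in F xi & integrable_gauges xi.

(** * Tree blow-ups *)

Record spanning_tree (t : rel 'I_N) : Prop := {
  tree_sub : subrel t e;
  tree_connected : connected_graph t;
  tree_acyclic : acyclic t }.

(* [inl i] is the node of the spanning tree t above i; [inr (i, j)] is the node
   added for the edge i > j of the graph outside t *)
Definition blowup (t : rel 'I_N) : finType :=
  ('I_N + {p : 'I_N * 'I_N | e p.2 p.1 && ~~ t p.2 p.1})%type.

Definition blowup_edge (t : rel 'I_N) : rel (blowup t) := fun u v =>
  match u, v with
  | inl j, inl i => t j i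
  | inl j, inr p => j == (val p).2
  | inr _, _ => false
  end.

Definition blowup_proj (t : rel 'I_N) (u : blowup t) : 'I_N :=
  match u with inl i => i | inr p => (val p).1 end.

Definition blowup_weight (t : rel 'I_N) (u v : blowup t) : R :=
  if adj (@blowup_edge t) u v
  then kappa (blowup_proj u) (blowup_proj v) else 0.

Definition blowup_laplacian (t : rel 'I_N) (x : signal R d (blowup t)) :
    signal R d (blowup t) :=
  [ffun u => - \sum_v (blowup_weight u v / degree (blowup_proj u)) *:
                 (x v - x u)].

(* sigma_1 and sigma_2 *)
Definition blowup_lift (t : rel 'I_N) (phi : Gamma) : Sec R d (blowup t) :=
  sec_of (fun u => sec_at phi (blowup_proj u)).

Definition blowup_push (t : rel 'I_N) (psi : Sec R d (blowup t)) : Gamma :=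
  sec_of (fun i => \sum_(u | blowup_proj u == i) sec_at psi u).

Definition tree_lifting (t : rel 'I_N) (F : Gamma -> Gamma) : Prop :=
  exists xi : gauge R d (blowup t),
    F =1 @blowup_push t \o sec xi \o @blowup_laplacian t \o triv xi
         \o @blowup_lift t.

End GaugedLaplacian.

(* Main.v *)
Require Import Defs.
From HB Require Import structures.
From mathcomp Require Import all_boot all_order all_algebra.
From mathcomp Require Import all_classical all_reals all_analysis.

Set Implicit Arguments.
Unset Strict Implicit.
Unset Printing Implicit Defensive.

Import Order.TTheory GRing.Theory Num.Theory.
Import numFieldNormedType.Exports.
Local Open Scope ring_scope.

(** In the gauge 1 every transformation F is a map on signals, and the gauged
    Laplacian of the class of (1, al) becomes
      x |-> - sum_j (kappa_ij / Z_i) (al_ij x_j - x_i),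
    the Laplacian transporting x_j to the node i by al_ij
    ([transport_laplacian]). Both properties say that F has this shape for some
    family g_ij in SO(d), attached to the oriented edges:

    - locally Laplacian in the gauges xi^i means that g_ij = xi^i_i (xi^i_j)^-1
      ([locally_laplacian_inP]), and the integrability condition says exactly
      that g_ij g_ji = 1; conversely a voltage al is obtained from the gauges
      xi^i_j = al_ji ([locally_laplacianP]);
    - in a tree blow-up every edge of the graph has exactly one lift, so that
      sigma_2 collects each neighbour j of i once, with
      g_ij = xi_I (xi_J)^-1 for the lifted edge (I, J)
      ([in_gauge_tree_lift]); the relation g_ij g_ji = 1 is then automatic.
      Conversely every voltage has this form, because voltages on a tree are
      coboundaries ([acyclic_potential], [blowup_potential]).

    A family with g_ij g_ji = 1 is a voltage on the edges, so F is a gauged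
    Laplacian; the voltage is determined by F because the coefficients
    kappa_ij / Z_i do not vanish on edges ([gauged_laplacian_inj]).

    For the heat kernel it remains to recover a linear operator A from the
    exponentials of - t A, t >= 0. In coordinates the exponential is a power
    series in t whose k-th coefficient is that of A^k v up to k!, and a power
    series with geometrically bounded such coefficients that vanishes for all
    t >= 0 has no linear term ([exp_series_coef1], [op_exp_generator_inj]). *)

(** * Operators are determined by their exponentials *)

Section LinearIterates.
Variables (R : comNzRingType) (V : lmodType R) (A : V -> V).
Hypothesis linA : linear A.

Let L : {linear V -> V} := HB.pack A (GRing.isLinear.Build _ _ _ _ A linA).

Lemma linear_scaleE r v : A (r *: v) = r *: A v.
Proof. exact: (linearZ_LR L r v). Qed.

Lemma linear_sumE (I : finType) (f : I -> V) :
  A (\sum_i f i) = \sum_i A (f i).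
Proof. exact: (linear_sum L). Qed.

Lemma iter_scale r k v :
  iter k (fun w => r *: A w) v = r ^+ k *: iter k A v.
Proof.
elim: k => [|k IHk]; first by rewrite scale1r.
by rewrite !iterS IHk linear_scaleE scalerA exprS.
Qed.

End LinearIterates.

(** The bound comes from the sum of the absolute values of the coordinates, a
    norm for which A is bounded by the sum of the norms of its columns. *)
Lemma coord_iter_bound (R : realType) (V : vectType R) (n : nat)
    (X : n.-tuple V) (A : V -> V) (v : V) :
  basis_of fullv X -> linear A ->
  exists C M : R, [/\ 0 <= C, 0 <= M &
    forall k i, `|coord X i (iter k A v)| <= C * M ^+ k].
Proof.
move=> basisX linA.
pose l1 w := \sum_i `|coord X i w|.
pose M := \sum_(j < n) l1 (A X`_j).
have l1_ge0 w : 0 <= l1 w by apply: sumr_ge0.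
have M_ge0 : 0 <= M by apply: sumr_ge0.
have coord_le w i : `|coord X i w| <= l1 w.
  by rewrite /l1 (bigD1 i) //= lerDl sumr_ge0.
have l1A w : l1 (A w) <= l1 w * M.
  rewrite {1}(coord_basis basisX (memvf w)) linear_sumE // {1}/l1.
  apply: (@le_trans _ _ (\sum_i \sum_j `|coord X j w| * `|coord X i (A X`_j)|)).
    apply: ler_sum => i _; rewrite linear_sum.
    apply: le_trans (ler_norm_sum _ _ _) _.
    by apply: ler_sum => j _; rewrite linear_scaleE // linearZ normrM.
  rewrite exchange_big /= [l1 w * M]mulr_sumr.
  apply: ler_sum => j _.
  by rewrite -mulr_sumr ler_wpM2r ?coord_le // l1_ge0.
exists (l1 v), M; split=> // k i.
apply: le_trans (coord_le _ _) _.
elim: k => [|k IHk]; first by rewrite expr0 mulr1.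
rewrite iterS exprSr mulrA; apply: le_trans (l1A _) _.
exact: ler_wpM2r.
Qed.

Section ExponentialSeries.
Variables (R : realType) (a : nat -> R) (C M : R).
Hypotheses (C_ge0 : 0 <= C) (M_ge0 : 0 <= M).
Hypothesis a_bound : forall k, `|a k| <= C * M ^+ k.

Definition exp_term (s : R) (k : nat) : R := s ^+ k * a k / k`!%:R.

Lemma exp_term_bound s k : `|exp_term s k| <= C * exp_coeff (`|s| * M) k.
Proof.
rewrite /exp_term /exp_coeff /= !normrM normfV normr_nat normrX mulrA.
by rewrite ler_wpM2r ?invr_ge0 // exprMn mulrCA ler_wpM2l ?exprn_ge0.
Qed.

Lemma cvg_exp_series s : cvgn (series (exp_term s)).
Proof.
apply: normed_cvg.
apply: (@series_le_cvg _ _ (fun k => C * exp_coeff (`|s| * M) k)) => [k|k|k|].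
- exact: normr_ge0.
- by rewrite mulr_ge0 // exp_coeff_ge0 // mulr_ge0.
- exact: exp_term_bound.
- exact: is_cvg_seriesZ (@is_cvg_series_exp_coeff R (`|s| * M)).
Qed.

(** For 0 < t <= 1 the terms of order at least 2 add up to at most t^2 B, with B
    independent of t; so the vanishing of the sum gives t |a_1| <= t^2 (B + 1)
    for all small t. *)
Lemma exp_series_coef1 :
  a 0%N = 0 -> (forall t, 0 <= t -> limn (series (exp_term (- t))) = 0) ->
  a 1%N = 0.
Proof.
move=> a0 lim0.
pose B := C * M ^+ 2 * expR M.
have B_ge0 : 0 <= B by rewrite !mulr_ge0 ?exprn_ge0 ?expR_ge0.
have tail t n : 0 <= t <= 1 ->
    `|series (exp_term (- t)) n.+2 + t * a 1%N| <= t ^+ 2 * B.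
  case/andP=> t_ge0 t_le1.
  rewrite seriesEnat /= 2?big_nat_recl //= /exp_term a0 mulr0 mul0r add0r.
  rewrite expr1 divr1 mulNr addrAC addNr add0r.
  apply: le_trans (ler_norm_sum _ _ _) _.
  apply: (@le_trans _ _ (\sum_(0 <= i < n) t ^+ 2 * (C * M ^+ 2 * exp_coeff M i))).
    apply: ler_sum => i _.
    rewrite 2!normrM normfV normr_nat normrX normrN (ger0_norm t_ge0).
    rewrite -mulrA; apply: ler_pM; rewrite ?exprn_ge0 ?mulr_ge0 ?invr_ge0 //.
      by rewrite -addn2 exprD ler_piMl ?exprn_ge0 ?exprn_ile1.
    rewrite /exp_coeff /= mulrA -(mulrA C) -exprD add2n.
    apply: ler_pM => //; rewrite ?invr_ge0 //.
    by rewrite lef_pV2 ?posrE ?ltr0n ?fact_gt0 // ler_nat !factS mulnA leq_pmull.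
  rewrite -!mulr_sumr ler_wpM2l ?exprn_ge0 // ler_wpM2l ?mulr_ge0 ?exprn_ge0 //.
  rewrite -[X in X <= _]/(series (exp_coeff M) n).
  apply: nondecreasing_cvgn_le; last exact: is_cvg_series_exp_coeff.
  apply/nondecreasing_seqP => k.
  by rewrite !seriesEnat /= big_nat_recr //= lerDl exp_coeff_ge0.
(* The additional t^2 absorbs the distance of a partial sum to its limit 0. *)
have small t : 0 < t <= 1 -> `|a 1%N| <= t * (B + 1).
  case/andP=> t_gt0 t_le1; have t_ge0 := ltW t_gt0.
  have cvg0 : (series (exp_term (- t)) @ \oo --> (0 : R))%classic.
    by rewrite -(lim0 t t_ge0); exact: cvg_exp_series.
  have [m _ near0] := cvgr0_norm_le _ cvg0 (t ^+ 2) (exprn_gt0 2 t_gt0).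
  have := tail t m; rewrite t_ge0 t_le1 => /(_ isT) tail_m.
  have near_m := near0 m.+2 (ltnW (leqnSn _)).
  rewrite -(ler_pM2l t_gt0) mulrA -expr2 -[X in X * `|_|](ger0_norm t_ge0) -normrM.
  rewrite mulrDr mulr1.
  apply: le_trans (lerD tail_m near_m).
  rewrite -[X in `|X| <= _](addKr (series (exp_term (- t)) m.+2)) addrC.
  exact: ler_normB.
apply/eqP; apply: contraT => a1_neq0.
have a1_gt0 : 0 < `|a 1%N| by rewrite normr_gt0.
(* At t = |a_1| / D <= 1, [small] reads D <= B + 1, that is |a_1| <= 0. *)
pose D := B + 1 + `|a 1%N|.
have B1_gt0 : 0 < B + 1 by rewrite ltr_wpDl.
have D_gt0 : 0 < D by rewrite addr_gt0.
have := small (`|a 1%N| / D); rewrite divr_gt0 // ler_pdivrMr // mul1r.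
rewrite lerDr (ltW B1_gt0) => /(_ isT).
rewrite mulrAC ler_pdivlMr // ler_pM2l // /D gerDl leNgt a1_gt0.
by [].
Qed.

End ExponentialSeries.

Lemma op_exp_coord (R : realType) (V : vectType R) (A : V -> V) (v : V)
    (i : 'I_(\dim {:V})) (s : R) :
  linear A ->
  coord (vbasis {:V}) i (op_exp (fun w => s *: A w) v)
  = limn (series (exp_term (fun k => coord (vbasis {:V}) i (iter k A v)) s)).
Proof.
move=> linA; rewrite /op_exp coord_sum_free ?(basis_free (vbasisP _)) //.
congr (limn (series _)); apply/funext => k.
by rewrite iter_scale // linearZ.
Qed.

(** The difference of the two exponential series satisfies the hypotheses of
    [exp_series_coef1] in each coordinate; its linear coefficient is the
    coordinate of A v - B v. *)
Lemma op_exp_generator_inj (R : realType) (V : vectType R) (A B : V -> V) :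
  linear A -> linear B ->
  (forall t, 0 <= t ->
     op_exp (fun w => - t *: A w) =1 op_exp (fun w => - t *: B w)) ->
  A = B.
Proof.
move=> linA linB expAB; apply/funext => v.
rewrite [LHS](coord_vbasis (memvf _)) [RHS](coord_vbasis (memvf _)).
apply: eq_bigr => i _; congr (_ *: _); apply/eqP; rewrite -subr_eq0; apply/eqP.
pose c D k := coord (vbasis {:V}) i (iter k D v).
have [C1 [M1 [C1_ge0 M1_ge0 bound1]]] := coord_iter_bound v (vbasisP _) linA.
have [C2 [M2 [C2_ge0 M2_ge0 bound2]]] := coord_iter_bound v (vbasisP _) linB.
have bound k : `|c A k - c B k| <= (C1 + C2) * (M1 + M2) ^+ k.
  apply: le_trans (ler_normB _ _) _; rewrite mulrDl lerD //.
    apply: le_trans (bound1 k i) _.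
    by rewrite ler_wpM2l // lerXn2r ?nnegrE ?addr_ge0 // lerDl.
  apply: le_trans (bound2 k i) _.
  by rewrite ler_wpM2l // lerXn2r ?nnegrE ?addr_ge0 // lerDr.
rewrite -[LHS]/(c A 1%N - c B 1%N).
apply: (exp_series_coef1 (a := fun k => c A k - c B k) _ _ bound);
  rewrite ?addr_ge0 //; first by rewrite /c subrr.
move=> t t_ge0.
have cvgA := cvg_exp_series C1_ge0 M1_ge0 (bound1^~ i) (s := - t).
have cvgB := cvg_exp_series C2_ge0 M2_ge0 (bound2^~ i) (s := - t).
have -> : series (exp_term (fun k => c A k - c B k) (- t))
    = series (exp_term (c A) (- t)) \- series (exp_term (c B) (- t)).
  apply/funext => n; rewrite !seriesEnat /= -sumrB; apply: eq_bigr => k _.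
  by rewrite /exp_term mulrBr mulrBl.
by rewrite (limB cvgA cvgB) -!op_exp_coord // expAB // subrr.
Qed.

(** * Voltages on a forest are coboundaries *)

(** By induction on the number of edges. When the edge {a, b} is removed, a and b
    lie in different components, as a path between them would close to a
    cycle. A potential of the remaining graph may be multiplied on the right by
    a constant on the component of b without losing its property, and one
    choice of the constant repairs the edge {a, b}. *)
Lemma acyclic_potential (G : groupType) (T : finType) (r : rel T)
    (al : T -> T -> G) :
  irreflexive r -> symmetric r ->
  (forall c : seq T, ucycle r c -> (size c <= 2)%N) ->
  (forall i j, r i j -> al i j = (al j i)^-1%g) ->
  exists p : T -> G, forall i j, r i j -> al i j = (p i * (p j)^-1)%g.
Proof.
have [n] := ubnP #|[pred q : T * T | r q.1 q.2]|.
elim: n r => // n IHn r lt_r_n irr_r sym_r acy_r alV.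
case: (pickP [pred q : T * T | r q.1 q.2]) => [[a b] /= r_ab|r0]; last first.
  by exists (fun=> 1%g) => i j r_ij; have := r0 (i, j); rewrite /= r_ij.
pose r' := [rel i j | r i j && ((i, j) != (a, b)) && ((i, j) != (b, a))].
have sub_r' : subrel r' r by move=> i j /andP[/andP[]].
have sym_r' : symmetric r'.
  move=> i j; rewrite /r' /= sym_r -!andbA; congr (_ && _).
  by rewrite !xpair_eqE andbC (andbC (j == b)) (andbC (j == a)).
have [|||||p p_r'] := IHn r'.
- rewrite -ltnS; apply: leq_trans lt_r_n; rewrite ltnS; apply: proper_card.
  apply/properP; split.
    by apply/fintype.subsetP => q; rewrite !inE => /sub_r'.
  by exists (a, b); rewrite !inE //= eqxx andbF.
- by move=> i; rewrite /r' /= irr_r.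
- exact: sym_r'.
- move=> c /andP[cyc_c uniq_c]; apply: acy_r; rewrite /ucycle uniq_c andbT.
  exact: sub_cycle cyc_c.
- by move=> i j /sub_r'; exact: alV.
have nconn_ba : ~~ connect r' b a.
  apply/negP => /connectP[q /shortenP[q' path_q' uniq_q' _] last_q'].
  have := acy_r (b :: q'); rewrite /ucycle uniq_q' andbT /= rcons_path.
  rewrite (sub_path sub_r' path_q') -last_q' r_ab => /(_ isT).
  case: q' path_q' last_q' {uniq_q'} => [|x [|y q']] //=.
    by move=> _ ab; rewrite ab irr_r in r_ab.
  move=> /andP[r'_bx _] ax _; move: r'_bx.
  by rewrite ax /r' /= eqxx andbF.
(* The constant is forced by al_ba = p'_b p_a^-1 for the new value p'_b. *)
pose c := ((p b)^-1 * (al b a * p a))%g.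
exists (fun i => if connect r' b i then (p i * c)%g else p i) => i j r_ij.
have [/eqP[-> ->]|ne1] := boolP ((i, j) == (a, b)).
  rewrite connect0 (negbTE nconn_ba) mulVKg invgM mulVKg.
  exact: alV.
have [/eqP[-> ->]|ne2] := boolP ((i, j) == (b, a)).
  by rewrite connect0 (negbTE nconn_ba) mulVKg mulgK.
have r'_ij : r' i j by rewrite /r' /= r_ij ne1 ne2.
have -> : connect r' b i = connect r' b j.
  apply/idP/idP => /connect_trans; apply; apply: connect1 => //.
  by rewrite sym_r'.
case: ifP => _; last exact: p_r'.
by rewrite (p_r' _ _ r'_ij) (invgM (p j)) mulgA mulgK.
Qed.

(** * Sections and transformations seen in a gauge *)

Section Frames.
Variables (R : realType) (d : nat) (I : finType).
Implicit Types (xi h : gauge R d I) (x : signal R d I) (phi : Sec R d I).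

Lemma gaugeM xi h i : (xi * h)%g i = (xi i * h i)%g.
Proof. by rewrite ffunE. Qed.

Lemma gaugeV xi i : xi^-1%g i = (xi i)^-1%g.
Proof. by rewrite ffunE. Qed.

Lemma gauge1 i : (1%g : gauge R d I) i = 1%g.
Proof. by rewrite ffunE. Qed.

Lemma secK xi : cancel (sec xi) (triv xi).
Proof. exact: clsK. Qed.

Lemma trivK xi : cancel (triv xi) (sec xi).
Proof. exact: frameK. Qed.

Lemma triv_sec xi h x i : triv xi (sec h x) i = ((xi i)^-1 * h i)%g *m x i.
Proof. by rewrite /triv /sec frame_cls ffunE gaugeM gaugeV. Qed.

Lemma so_mulM (g h : SO R d) (v : 'cV[R]_d) : (g * h)%g *m v = g *m (h *m v).
Proof. exact: so_actM. Qed.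

Lemma so_mulK (g : SO R d) (v : 'cV[R]_d) : g^-1%g *m (g *m v) = v.
Proof. by rewrite -so_mulM mulVg mul1mx. Qed.

Lemma so_mulVK (g : SO R d) (v : 'cV[R]_d) : g *m (g^-1%g *m v) = v.
Proof. by rewrite -so_mulM mulgV mul1mx. Qed.

Lemma frame_sec_at xi phi i :
  frame (xi i) (sec_at phi i) = triv xi phi i.
Proof. by rewrite -{1}(trivK xi phi) sec_at_sec clsK. Qed.

Lemma triv_sec_of xi (y : I -> fibre R d) i :
  triv xi (sec_of y) i = frame (xi i) (y i).
Proof. by rewrite -frame_sec_at sec_ofK. Qed.

Lemma frame_sum (J : finType) (P : pred J) g (y : J -> fibre R d) :
  frame g (\sum_(j | P j) y j) = \sum_(j | P j) frame g (y j) :> 'cV[R]_d.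
Proof.
by apply: (big_morph (frame g : fibre R d -> _)) => [p q|];
  [exact: frameD|exact: frame0].
Qed.

(** Comparing every gauge with the gauge 1 puts statements made in the different
    gauges xi^i on the same footing. *)
Lemma in_gauge_change (F : Sec R d I -> Sec R d I) xi x i :
  in_gauge F xi x i =
  (xi i)^-1%g *m in_gauge F 1%g (gauge_act xi x) i.
Proof.
have := in_gauge_equivariant F 1%g xi^-1%g (gauge_act xi x).
rewrite invgK mul1g /= -gauge_actM mulVg gauge_act1 => ->.
by rewrite ffunE gaugeV.
Qed.

End Frames.

(** * Transport Laplacians and locally Laplacian transformations *)

Section VoltageLaplacian.
Variables (R : realType) (N d : nat) (e : rel 'I_N) (kappa : 'I_N -> 'I_N -> R).
Hypotheses (eP : connected_simple_digraph e) (kappaP : edge_weight e kappa).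

Local Notation Xi := (gauge R d 'I_N).
Local Notation X := (signal R d 'I_N).
Local Notation Gamma := (Sec R d 'I_N).
Local Notation Z := (degree kappa).

Lemma adj_irr : irreflexive (adj e).
Proof.
move=> i; rewrite /adj orbb; apply/negbTE/negP => e_ii.
by have := edge_asym eP e_ii; rewrite e_ii.
Qed.

Lemma weight_ge0 i j : 0 <= kappa i j.
Proof.
have [ij|ij] := boolP (adj e i j); first exact: ltW (weight_gt0 kappaP ij).
by rewrite (weight_eq0 kappaP ij).
Qed.

Lemma degree_gt0 i j : adj e i j -> 0 < Z i.
Proof.
move=> ij; rewrite /degree (bigD1 j) //= ltr_pwDl ?(weight_gt0 kappaP ij) //.
by apply: sumr_ge0 => k _; exact: weight_ge0.
Qed.

Definition edge_voltage_fun (g : 'I_N -> 'I_N -> SO R d) :=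
  [ffun i => [ffun j => if adj e i j then g i j else 1%g]].

Lemma edge_voltage (g : 'I_N -> 'I_N -> SO R d) :
  (forall i j, adj e i j -> g i j = (g j i)^-1%g) ->
  exists al : voltage R d e, forall i j, adj e i j -> al i j = g i j.
Proof.
move=> gV; have voltP : is_voltage e (edge_voltage_fun g).
  apply/forallP => i; apply/forallP => j; rewrite !ffunE -(adjC e i j).
  by case: (boolP (adj e i j)) => ij //; apply/eqP; exact: gV.
by exists (Voltage voltP) => i j ij; rewrite /= !ffunE ij.
Qed.

(** In the gauge 1, the common form of the transformations with either property;
    whether [g] comes from a voltage is a separate matter, decided by its
    antisymmetry on the edges. *)
Definition transport_laplacian (g : 'I_N -> 'I_N -> SO R d) (x : X) (i : 'I_N) :
    'cV[R]_d :=
  - \sum_j (kappa i j / Z i) *: (g i j *m x j - x i).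

Lemma eq_transport_laplacian g g' :
  (forall i j, adj e i j -> g i j = g' i j) ->
  transport_laplacian g =2 transport_laplacian g'.
Proof.
move=> eq_g x i; congr (- _); apply: eq_bigr => j _.
have [/eq_g -> //|ij] := boolP (adj e i j).
by rewrite (weight_eq0 kappaP ij) mul0r !scale0r.
Qed.

(** Evaluating at the node i on signals supported at a neighbour j isolates
    kappa_ij / Z_i times a column of al_ij. *)
Lemma laplacian_inj (al al' : voltage R d e) :
  laplacian kappa al =1 laplacian kappa al' -> al = al'.
Proof.
move=> eqL; apply/val_inj/ffunP => i; apply/ffunP => j; apply/val_inj => /=.
have [ij|ij] := boolP (adj e i j); last by rewrite !voltage_nadj.
have ne_ji : j != i by apply: contraTneq ij => ->; rewrite adj_irr.
apply/matrixP => k l.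
pose x : X := [ffun m => if m == j then delta_mx l 0 else 0].
have lapx (be : voltage R d e) :
    laplacian kappa be x i = - ((kappa i j / Z i) *: col l (be i j)).
  rewrite ffunE (bigD1 j) //= big1 => [|m ne_mj]; rewrite !ffunE.
    by rewrite eqxx eq_sym (negbTE ne_ji) subr0 addr0 -colE.
  by rewrite (negbTE ne_mj) eq_sym (negbTE ne_ji) mulmx0 subrr scaler0.
have coef_neq0 : kappa i j / Z i != 0.
  by rewrite gt_eqF // divr_gt0 ?(degree_gt0 ij) ?(weight_gt0 kappaP ij).
have := congr1 (fun y : X => y i) (eqL x); rewrite !lapx.
by move=> /oppr_inj/(scalerI coef_neq0)/colP/(_ k); rewrite !mxE.
Qed.

Lemma gvoltE (om : gvoltage R d e) : exists al, om = gvolt 1%g al.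
Proof. by exists (frame 1%g om); rewrite /gvolt frameK. Qed.

Lemma in_gauge_gvolt xi (al : voltage R d e) x :
  in_gauge (gauged_laplacian kappa (gvolt xi al)) xi x = laplacian kappa al x.
Proof. by rewrite /in_gauge gauged_laplacianE // secK. Qed.

Lemma in_gauge_laplacian (al : voltage R d e) x i :
  in_gauge (gauged_laplacian kappa (gvolt 1%g al)) 1%g x i
  = transport_laplacian (fun k j => al k j) x i.
Proof. by rewrite in_gauge_gvolt ffunE. Qed.

Lemma gauged_laplacian_inj :
  injective (@gauged_laplacian R N d e kappa).
Proof.
move=> om om'; have [al ->] := gvoltE om; have [al' ->] := gvoltE om' => eqL.
congr gvolt; apply: laplacian_inj => x.
by rewrite -!(in_gauge_gvolt 1%g) eqL.
Qed.

Lemma exists_unique_gauged_laplacian (F : Gamma -> Gamma) :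
  (exists om : gvoltage R d e, F = gauged_laplacian kappa om) ->
  exists! om : gvoltage R d e, F = gauged_laplacian kappa om.
Proof.
move=> [om ->]; exists om; split=> [|om' eqL]; first exact: erefl.
exact: gauged_laplacian_inj eqL.
Qed.

Lemma in_gauge_inj (F G : Gamma -> Gamma) :
  (forall x i, in_gauge F 1%g x i = in_gauge G 1%g x i) -> F = G.
Proof.
move=> eqFG; apply/funext => phi; rewrite -(trivK 1%g phi) !in_gaugeE.
by congr sec; apply/ffunP => i.
Qed.

Lemma transport_gauged_laplacian (F : Gamma -> Gamma) g :
  (forall i j, adj e i j -> g i j = (g j i)^-1%g) ->
  (forall x i, in_gauge F 1%g x i = transport_laplacian g x i) ->
  exists om : gvoltage R d e, F = gauged_laplacian kappa om.
Proof.
move=> gV Fg; have [al al_g] := edge_voltage gV.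
exists (gvolt 1%g al); apply: in_gauge_inj => x i.
by rewrite Fg in_gauge_laplacian; apply: eq_transport_laplacian => k j /al_g.
Qed.

Lemma locally_laplacian_inP (F : Gamma -> Gamma) (xi : 'I_N -> Xi) :
  locally_laplacian_in kappa F xi <->
  forall x i, in_gauge F 1%g x i =
    transport_laplacian (fun i j => xi i i * (xi i j)^-1)%g x i.
Proof.
have pull (x : X) i : - (\sum_j (kappa i j / Z i) *: (x j - x i))
    = (xi i i)^-1%g *m
      transport_laplacian (fun i j => xi i i * (xi i j)^-1)%g
        (gauge_act (xi i) x) i.
  rewrite mulmxN mulmx_sumr; congr (- _); apply: eq_bigr => j _.
  by rewrite -scalemxAr mulmxBr !ffunE so_mulM !so_mulK.
split=> [locF x i | Fx i x]; last by rewrite in_gauge_change Fx -pull.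
have := locF i (gauge_act (xi i)^-1%g x).
rewrite in_gauge_change pull -gauge_actM mulgV gauge_act1.
by move/(congr1 (mulmx (xi i i))); rewrite !so_mulVK.
Qed.

(** Integrability of the gauges is the antisymmetry of
    g_ij = xi^i_i (xi^i_j)^-1. Conversely the voltage itself provides gauges in
    which the parallel transports into i become trivial. *)
Lemma locally_laplacianP (F : Gamma -> Gamma) :
  locally_laplacian_integrable kappa F <->
  exists om : gvoltage R d e, F = gauged_laplacian kappa om.
Proof.
split=> [[xi /locally_laplacian_inP Fxi int_xi] | [om ->]].
  apply: transport_gauged_laplacian Fxi => i j _; have := int_xi i j.
  rewrite /associated_gauge !gaugeM !gaugeV invgM invgK => int_ij.
  by rewrite -[xi j i](mulVKg (xi i i)) int_ij !mulgA mulgK.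
have [al ->] := gvoltE om.
have diag i : al i i = 1%g by rewrite voltage_nadj ?adj_irr.
have alV i j : al i j = (al j i)^-1%g.
  have [/voltage_adj //|ij] := boolP (adj e i j).
  by rewrite !voltage_nadj ?invg1 // adjC.
(* As al_ii = 1, the gauge xi^i_j = al_ji gives xi^i_i (xi^i_j)^-1 = al_ij. *)
exists (fun i => [ffun j => al j i]).
  apply/locally_laplacian_inP => x i; rewrite in_gauge_laplacian.
  by apply: eq_transport_laplacian => k j _; rewrite !ffunE diag mul1g -alV.
move=> i j; rewrite /associated_gauge !gaugeM !gaugeV !ffunE !diag.
by rewrite invg1 mul1g mulg1 -alV.
Qed.

(** * Tree blow-ups *)

Section BlowUp.
Variable t : rel 'I_N.
Hypothesis tP : spanning_tree e t.

Local Notation nodes := (blowup e t).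
Local Notation proj := (@blowup_proj N e t).
Local Notation edge := (@blowup_edge N e t).

(** For adjacent i and j, the end above i of the unique lift of the edge between
    i and j: the added node if the edge is not in the tree and i is its
    terminal node, and the tree node above i otherwise. *)
Definition edge_end (i j : 'I_N) : nodes :=
  if insub (i, j) is Some p then inr p else inl i.

Lemma proj_edge_end i j : proj (edge_end i j) = i.
Proof. by rewrite /edge_end; case: insubP => //= p _ ->. Qed.

Lemma edge_end_inl i j : t j i || e i j -> edge_end i j = inl i.
Proof.
move=> ij; rewrite /edge_end insubF //=; case/orP: ij => [->|ij].
  by rewrite andbF.
by rewrite (negbTE (edge_asym eP ij)).
Qed.

Lemma blowup_edge_end i j : e j i -> edge (edge_end j i) (edge_end i j).
Proof.
move=> ji; rewrite (edge_end_inl (i := j)) ?ji ?orbT // /edge_end.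
case: insubP => [p _ /= -> // | /=].
by rewrite ji negbK.
Qed.

Lemma adj_edge_end i j : adj e i j -> adj edge (edge_end i j) (edge_end j i).
Proof. by case/orP => /blowup_edge_end; rewrite /adj => ->; rewrite ?orbT. Qed.

Lemma blowup_edgeP u v :
  edge u v -> [/\ e (proj u) (proj v), edge_end (proj u) (proj v) = u &
                   edge_end (proj v) (proj u) = v].
Proof.
case: u v => [j|q] [i|p] //= => [ji|/eqP ->].
  have eji := tree_sub tP ji.
  by rewrite !edge_end_inl ?ji ?eji ?orbT.
case: p => [[i k] /= ik]; case/andP: (ik) => e_ki _.
split=> //; first by rewrite edge_end_inl ?e_ki ?orbT.
by rewrite /edge_end insubT; congr inr; apply/val_inj.
Qed.

Lemma adj_blowupP u v :
  adj edge u v -> [/\ adj e (proj u) (proj v), edge_end (proj u) (proj v) = u &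
                      edge_end (proj v) (proj u) = v].
Proof.
by rewrite /adj => /orP[] /blowup_edgeP[-> -> ->]; rewrite ?orbT.
Qed.

(** The edges of the blow-up meeting the fibre over i correspond bijectively to
    the neighbours of i. *)
Lemma sum_blowup_edges (V : zmodType) (F : nodes -> nodes -> V) i :
  \sum_(u | proj u == i) \sum_(v | adj edge u v) F u v
  = \sum_(j | adj e i j) F (edge_end i j) (edge_end j i).
Proof.
rewrite pair_big_dep /=.
rewrite (reindex_onto (fun j => (edge_end i j, edge_end j i))
  (fun q => proj q.2)) /=.
  apply: eq_bigl => j; rewrite !proj_edge_end !eqxx andbT /=.
  apply/idP/idP => [/adj_blowupP[] | /adj_edge_end //].
  by rewrite !proj_edge_end.
by move=> [u v] /= /andP[/eqP <- /adj_blowupP[_ -> ->]].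
Qed.

(** Seen in the gauge 1, sigma_1 copies x_i to all nodes above i and sigma_2 adds
    their values up again; the sum over the edges of the blow-up is then
    [sum_blowup_edges]. *)
Lemma in_gauge_tree_lift (xi : gauge R d nodes) (x : X) i :
  in_gauge (@blowup_push R N d e t \o sec xi \o @blowup_laplacian R N d e kappa t
            \o triv xi \o @blowup_lift R N d e t) 1%g x i
  = transport_laplacian
      (fun i j => xi (edge_end i j) * (xi (edge_end j i))^-1)%g x i.
Proof.
rewrite /in_gauge /= /blowup_push triv_sec_of gauge1 frame_sum.
pose F u v := - ((kappa (proj u) (proj v) / Z (proj u)) *:
   ((xi u * (xi v)^-1)%g *m x (proj v) - x (proj u))).
transitivity (\sum_(u | proj u == i) \sum_(v | adj edge u v) F u v).
  apply: eq_bigr => u _; rewrite sec_at_sec frame_cls /= invg1 mul1g.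
  rewrite ffunE /so_act mulmxN mulmx_sumr sumrN; congr (- _).
  rewrite [RHS]big_mkcond /=; apply: eq_bigr => v _.
  rewrite -scalemxAr /blowup_weight.
  case: ifP => _; last by rewrite mul0r scale0r.
  congr (_ *: _); rewrite mulmxBr !triv_sec_of !sec_at_sec.
  rewrite !frame_cls !gauge1 !mulg1.
  by rewrite -[so_lin_action _ _ _ _]/(_ *m _) so_mulVK mulmxA.
rewrite sum_blowup_edges sumrN; congr (- _); rewrite [LHS]big_mkcond.
apply: eq_bigr => j _; rewrite !proj_edge_end.
by case: ifPn => // ij; rewrite (weight_eq0 kappaP ij) mul0r scale0r.
Qed.

(** A potential on the spanning tree extends to the added nodes, each of them
    being a leaf. *)
Lemma blowup_potential (al : voltage R d e) :
  exists xi : gauge R d nodes, forall i j, adj e i j ->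
    al i j = (xi (edge_end i j) * (xi (edge_end j i))^-1)%g.
Proof.
have sub_te i j : adj t i j -> adj e i j.
  by case/orP => /(tree_sub tP) ij; rewrite /adj ij ?orbT.
have [||||p al_p] := @acyclic_potential (SO R d) _ (adj t) (fun i j => al i j).
- by move=> i; apply/negbTE/negP => /sub_te; rewrite adj_irr.
- exact: adjC.
- exact: tree_acyclic tP.
- by move=> i j /sub_te; exact: voltage_adj.
pose xi (u : nodes) : SO R d :=
  match u with
  | inl i => p i
  | inr q => (al (val q).1 (val q).2 * p (val q).2)%g
  end.
have xi_e i j : e j i ->
    al i j = (xi (edge_end i j) * (xi (edge_end j i))^-1)%g.
  move=> ji; rewrite (edge_end_inl (i := j)) ?ji ?orbT // /edge_end.
  case: insubP => [q _ /= -> /= | /=]; first by rewrite mulgK.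
  by rewrite ji negbK => t_ji; apply: al_p; rewrite /adj t_ji orbT.
exists [ffun u => xi u] => i j ij; rewrite !ffunE.
case/orP: (ij) => [/xi_e al_ji | /xi_e //].
by rewrite (voltage_adj al ij) al_ji invgM invgK.
Qed.

Lemma tree_liftingP (F : Gamma -> Gamma) :
  tree_lifting e kappa t F <->
  exists om : gvoltage R d e, F = gauged_laplacian kappa om.
Proof.
split=> [[xi /funext ->] | [om ->]].
  apply: transport_gauged_laplacian (in_gauge_tree_lift xi) => i j _.
  by rewrite invgM invgK.
have [al ->] := gvoltE om; have [xi al_xi] := blowup_potential al.
exists xi => phi; apply: (congr1 (fun G : Gamma -> Gamma => G phi)).
apply: in_gauge_inj => x i; rewrite in_gauge_tree_lift in_gauge_laplacian.
exact: eq_transport_laplacian.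
Qed.

End BlowUp.

(** * The heat kernel *)

Lemma gauged_laplacian_linear (om : gvoltage R d e) :
  linear (gauged_laplacian kappa om).
Proof.
have [al ->] := gvoltE om => r phi psi.
rewrite -(trivK 1%g phi) -(trivK 1%g psi).
move: (triv 1%g phi) (triv 1%g psi) => x y.
have sec_lin : linear (sec 1%g : X -> Gamma) by exact: cls_linear.
rewrite -sec_lin !gauged_laplacianE // -sec_lin; congr sec; apply/ffunP => i.
rewrite !ffunE scalerN -opprD scaler_sumr -big_split; congr (- _).
apply: eq_bigr => j _; rewrite /= !ffunE scalerA [r * _]mulrC.
rewrite -[(_ * r) *: _]scalerA -scalerDr.
by congr (_ *: _); rewrite linearP scalerBr opprD addrACA.
Qed.

Lemma heat_kernel_generatorP (om : gvoltage R d e) (A : Gamma -> Gamma) :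
  is_generator (heat_kernel kappa om) A <-> A = gauged_laplacian kappa om.
Proof.
split=> [[linA genA] | ->]; last by split=> //; exact: gauged_laplacian_linear.
apply: op_exp_generator_inj linA (gauged_laplacian_linear om) _ => s s_ge0 phi.
by rewrite -(genA s s_ge0).
Qed.

(** A family K generated by A is the heat kernel of om exactly when A is the
    gauged Laplacian of om, so uniqueness of om for K is uniqueness for A. *)
Lemma generator_heat_kernelP (K : R -> Gamma -> Gamma) (A : Gamma -> Gamma) :
  is_generator K A ->
  (exists om : gvoltage R d e, A = gauged_laplacian kappa om) <->
  (exists! om : gvoltage R d e,
     forall s : R, 0 <= s -> K s =1 heat_kernel kappa om s).
Proof.
move=> [linA genA].
have kernelP (om : gvoltage R d e) :
    (forall s, 0 <= s -> K s =1 heat_kernel kappa om s) <->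
    A = gauged_laplacian kappa om.
  split=> [K_om | A_om s s_ge0 phi]; last first.
    by rewrite (genA s s_ge0) /heat_kernel -A_om.
  apply: (proj1 (heat_kernel_generatorP om A)).
  split=> [|s s_ge0 phi]; first exact: linA.
  by rewrite -(K_om s s_ge0) (genA s s_ge0).
split=> [/exists_unique_gauged_laplacian [om [A_om uniq_om]]
  | [om [/kernelP A_om _]]].
  by exists om; split=> [|om' /kernelP/uniq_om //]; exact/kernelP.
by exists om.
Qed.

End VoltageLaplacian.

Theorem theorem3p14 (R : realType) (N d : nat) (e : rel 'I_N)
    (kappa : 'I_N -> 'I_N -> R)
    (N_gt0 : (0 < N)%N) (d_gt0 : (0 < d)%N)
    (eP : connected_simple_digraph e) (kappaP : edge_weight e kappa) :
  (* the gauged Laplacians are exactly the locally Laplacian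
     transformations satisfying the integrability condition *)
  ((forall om : gvoltage R d e,
      locally_laplacian_integrable kappa (gauged_laplacian kappa om))
   /\
   (forall F : Sec R d 'I_N -> Sec R d 'I_N,
      locally_laplacian_integrable kappa F ->
      exists! om : gvoltage R d e, F = gauged_laplacian kappa om))
  /\
  (* the gauged Laplacians are exactly the transformations with the lifting property,
     for every tree blow-up *)
  (forall t : rel 'I_N, spanning_tree e t ->
     (forall om : gvoltage R d e,
        tree_lifting e kappa t (gauged_laplacian kappa om))
     /\
     (forall F : Sec R d 'I_N -> Sec R d 'I_N,
        tree_lifting e kappa t F ->
        exists! om : gvoltage R d e, F = gauged_laplacian kappa om))
  /\
  (* the gauged Laplacian is the only generator of the gauged heat kernel *)
  (forall (om : gvoltage R d e) (A : Sec R d 'I_N -> Sec R d 'I_N),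
     is_generator (heat_kernel kappa om) A <-> A = gauged_laplacian kappa om)
  /\
  (* a family with a generator is a gauged heat kernel if and only if its
     generator has the first property, if and only if it has the second *)
  (forall (K : R -> Sec R d 'I_N -> Sec R d 'I_N)
          (A : Sec R d 'I_N -> Sec R d 'I_N),
     is_generator K A ->
     (locally_laplacian_integrable kappa A <->
      exists! om : gvoltage R d e,
        forall s : R, 0 <= s -> K s =1 heat_kernel kappa om s)
     /\
     (forall t : rel 'I_N, spanning_tree e t ->
        (tree_lifting e kappa t A <->
         exists! om : gvoltage R d e,
           forall s : R, 0 <= s -> K s =1 heat_kernel kappa om s))).
Proof.
split; [split|split; [|split]].
- by move=> om; apply: (proj2 (locally_laplacianP eP kappaP _)); exists om.
- by move=> F /(locally_laplacianP eP kappaP)/(exists_unique_gauged_laplacian eP kappaP).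
- move=> t tP; split=> [om|F].
    by apply: (proj2 (tree_liftingP eP kappaP tP _)); exists om.
  by move=> /(tree_liftingP eP kappaP tP)/(exists_unique_gauged_laplacian eP kappaP).
- by move=> om A; exact: heat_kernel_generatorP.
- move=> K A /(generator_heat_kernelP eP kappaP) K_A.
  split=> [|t tP]; first exact: (iff_trans (locally_laplacianP eP kappaP A) K_A).
  exact: (iff_trans (tree_liftingP eP kappaP tP A) K_A).
Qed.
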